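(* Let $N\ge 1$, let $\varphi \in \mathbb{C}^N \setminus \{0\}$ and let $\Lambda$ be a subgroup of $(\mathbb{Z}/N\mathbb{Z}) \times (\mathbb{Z}/N\mathbb{Z})^{\widehat{}}$. Then the Gabor system $(\varphi, \Lambda)$ is a tight frame for $\mathbb{C}^N$ if and only if $A_p(\varphi)$ is $\Lambda^\circ$-sparse. Moreover, in this case the frame bound is $|\Lambda|\, A_p(\varphi)[0,0]$.
   Context: Vectors in $\mathbb{C}^N$ are indexed by $\mathbb{Z}/N\mathbb{Z}$, and $\langle x,y\rangle=\sum_j x[j]\overline{y[j]}$. The character group $(\mathbb{Z}/N\mathbb{Z})^{\widehat{}}$ is identified with $\mathbb{Z}/N\mathbb{Z}$. Translation and modulation are $\tau_k(\varphi)[j]=\varphi[j-k]$ and $e_\ell(\varphi)[j]=e^{2\pi i j\ell/N}\varphi[j]$. The Gabor system generated by $\varphi$ and $\Lambda$ is the family $(\varphi,\Lambda)=\{e_\ell\tau_k\varphi:(k,\ell)\in\Lambda\}$, indexed by $\Lambda$. A finite family $\{v_i\}$ in $\mathbb{C}^N$ is a tight frame with frame bound $A>0$ if $\sum_i|\langle x,v_i\rangle|^2=A\|x\|_2^2$ for all $x\in\mathbb{C}^N$. The adjoint subgroup of $\Lambda$ is $\Lambda^\circ=\{(m,n)\in(\mathbb{Z}/N\mathbb{Z})\times(\mathbb{Z}/N\mathbb{Z})^{\widehat{}}: e_n\tau_m e_\ell\tau_k=e_\ell\tau_k e_n\tau_m \text{ for all }(k,\ell)\in\Lambda\}$. The discrete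 periodic ambiguity function of $\varphi$ is $A_p(\varphi)[m,n]=\frac1N\sum_{k=0}^{N-1}\varphi[k+m]\overline{\varphi[k]}e^{-2\pi i nk/N}$. $A_p(\varphi)$ is called $\Lambda^\circ$-sparse if $A_p(\varphi)[m,n]=0$ for every $(m,n)\in\Lambda^\circ\setminus\{(0,0)\}$. *)

(* Defs.v *)
From HB Require Import structures.
From mathcomp Require Import all_boot all_order all_algebra all_fingroup.
From mathcomp Require Import complex.
From mathcomp Require Import reals trigo.

Set Implicit Arguments.
Unset Strict Implicit.
Unset Printing Implicit Defensive.

Import Order.TTheory GRing.Theory Num.Theory.

Local Open Scope ring_scope.

(* [Z/NZ] is ['I_n.+1] with [N = n.+1]: unlike ['Z_N], this is also correct
   for [N = 1].  Index arithmetic ([j - k], [k + m]) is thus modulo [N].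
   A subgroup of [Z/NZ x (Z/NZ)^] is a [{group 'I_n.+1 * 'I_n.+1}]; its
   multiplicatively written law is convertible to componentwise addition
   modulo [N]. *)

Definition expi {R : realType} (t : R) : R[i] := (cos t +i* sin t)%C.

Definition inner {R : realType} {n : nat} (x y : 'cV[R[i]]_n.+1) : R[i] :=
  \sum_(j < n.+1) x j 0 * (y j 0)^*.

(* A family indexed by the subset [D] of [I], so that repeated vectors are
   counted with multiplicity.  The identity is stated in [R[i]], where norms
   of complex numbers live. *)
Definition tight_frame_with_bound {R : realType} {n : nat} {I : finType}
    (D : {set I}) (v : I -> 'cV[R[i]]_n.+1) (A : R) : Prop :=
  0 < A /\ forall x : 'cV[R[i]]_n.+1,
    \sum_(i in D) `|inner x (v i)| ^+ 2
    = A%:C%C * \sum_(j < n.+1) `|x j 0| ^+ 2.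

Definition tight_frame {R : realType} {n : nat} {I : finType}
    (D : {set I}) (v : I -> 'cV[R[i]]_n.+1) : Prop :=
  exists A : R, tight_frame_with_bound D v A.

Definition translation {R : realType} {n : nat} (k : 'I_n.+1)
    (phi : 'cV[R[i]]_n.+1) : 'cV[R[i]]_n.+1 :=
  \col_j phi (j - k) 0.

(* The character of index [l], and below the one in [ambiguity], is computed
   with the representatives of the indices in [0, N-1]. *)
Definition modulation {R : realType} {n : nat} (l : 'I_n.+1)
    (phi : 'cV[R[i]]_n.+1) : 'cV[R[i]]_n.+1 :=
  \col_j (expi (2 * pi * (j * l)%N%:R / n.+1%:R) * phi j 0).

(* The time-frequency shift [e_l tau_k], for [p = (k, l)]. *)
Definition tf_shift {R : realType} {n : nat} (p : 'I_n.+1 * 'I_n.+1)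
    (phi : 'cV[R[i]]_n.+1) : 'cV[R[i]]_n.+1 :=
  modulation p.2 (translation p.1 phi).

Definition gabor {R : realType} {n : nat} (phi : 'cV[R[i]]_n.+1)
    (p : 'I_n.+1 * 'I_n.+1) : 'cV[R[i]]_n.+1 :=
  tf_shift p phi.

(* Membership in the adjoint subgroup.  [R] is explicit because the operators
   act on vectors over [R[i]], whereas [Lambda] and [q] do not mention it. *)
Definition in_adjoint (R : realType) {n : nat}
    (Lambda : {set 'I_n.+1 * 'I_n.+1}) (q : 'I_n.+1 * 'I_n.+1) : Prop :=
  forall p, p \in Lambda ->
    @tf_shift R n q \o tf_shift p =1 tf_shift p \o tf_shift q.

Definition ambiguity {R : realType} {n : nat} (phi : 'cV[R[i]]_n.+1)
    (m l : 'I_n.+1) : R[i] :=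
  n.+1%:R^-1 * \sum_(k < n.+1)
    phi (k + m) 0 * (phi k 0)^* * expi (- (2 * pi * (l * k)%N%:R / n.+1%:R)).

Definition adjoint_sparse {R : realType} {n : nat}
    (Lambda : {set 'I_n.+1 * 'I_n.+1}) (phi : 'cV[R[i]]_n.+1) : Prop :=
  forall m l : 'I_n.+1,
    in_adjoint R Lambda (m, l) -> (m, l) <> (0, 0) -> ambiguity phi m l = 0.

(* Main.v *)
(** The frame operator [S], the sum of the rank-one matrices [v v^*] over the
    system, is compared with a scalar matrix through the coefficients
    [N^-1 \sum_k M (k + m, k) e^(-2 pi i l k / N)], which determine [M] by
    Fourier inversion on each diagonal.  At [phi phi^*] they give the ambiguity
    function of [phi]; conjugating by the time-frequency shift [p] multiplies
    the coefficient of index [q] by a character of [p], which is trivial on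
    [Lambda] exactly when [q] lies in the adjoint subgroup.  Summing over
    [Lambda], orthogonality shows that the coefficient of [S] at [q] is
    [#|Lambda|] times the ambiguity function when [q] is in the adjoint
    subgroup, and [0] otherwise; those of a scalar matrix vanish off [q = 0]. *)

Require Import Defs.
From HB Require Import structures.
From mathcomp Require Import all_boot all_order all_algebra all_fingroup.
From mathcomp Require Import complex.
From mathcomp Require Import reals trigo.
From mathcomp Require Import ring lra.

Set Implicit Arguments.
Unset Strict Implicit.
Unset Printing Implicit Defensive.

Import Order.TTheory GRing.Theory Num.Theory.

Local Open Scope ring_scope.

(** * The complex exponential and the characters of Z/NZ *)

Lemma expiD (R : realType) (s t : R) : expi (s + t) = expi s * expi t.
Proof.
rewrite /expi cosD sinD; apply/eqP; rewrite eq_complex /=.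
by rewrite eqxx /= addrC eqxx.
Qed.

Lemma expiN (R : realType) (t : R) : expi (- t) = (expi t)^*.
Proof. by rewrite /expi cosN sinN. Qed.

Lemma expi_mul_conj (R : realType) (t : R) : expi t * (expi t)^* = 1.
Proof. by rewrite -expiN -expiD subrr /expi cos0 sin0. Qed.

Lemma expi_mulrn (R : realType) (t : R) k : expi (t * k%:R) = expi t ^+ k.
Proof.
elim: k => [|k IHk]; last by rewrite exprS -IHk -expiD -nat1r mulrDr mulr1.
by rewrite mulr0 expr0 /expi cos0 sin0.
Qed.

(** The real part is [1 - 2 sin(t/2)^2], and [sin(t/2) > 0] because [t/2] lies strictly between 0
    and pi. *)
Lemma expi_neq1 (R : realType) (t : R) : 0 < t -> t < 2 * pi -> expi t != 1.
Proof.
move=> t0 t2; apply/negP => /eqP [+ _].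
have -> : t = (t / 2) *+ 2 by rewrite -mulr_natr divfK// pnatr_eq0.
rewrite cos_mulr2n cos2sin2 => cos1.
have /gt_eqF/negP[] : 0 < sin (t / 2).
  by apply: sin_gt0_pi; rewrite divr_gt0//= ltr_pdivrMr// mulrC.
by rewrite -sqrf_eq0; apply/eqP; lra.
Qed.

Section Characters.
Variables (R : realType) (n : nat).
Implicit Types a b c l m k : 'I_n.+1.

Definition chi a b : R[i] := expi (2 * pi * (a * b)%N%:R / n.+1%:R).

Lemma chiE a b : chi a b = expi (2 * pi / n.+1%:R) ^+ (a * b).
Proof. by rewrite -expi_mulrn mulrAC. Qed.

Lemma chiC a b : chi a b = chi b a.
Proof. by rewrite /chi mulnC. Qed.

(** The index sum is reduced modulo N, which is harmless because the base of the power is an N-th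
    root of unity. *)
Lemma chiDl a b c : chi (a + b) c = chi a c * chi b c.
Proof.
have zN : expi (2 * pi / n.+1%:R : R) ^+ n.+1 = 1.
  by rewrite -expi_mulrn divfK ?pnatr_eq0// mulrC mulr_natr /expi cos2pi sin2pi.
by rewrite !chiE -exprD -mulnDl !exprM /= expr_mod.
Qed.

Lemma chiDr a b c : chi c (a + b) = chi c a * chi c b.
Proof. by rewrite !(chiC c) chiDl. Qed.

Lemma chi_mul_conj a b : chi a b * (chi a b)^* = 1.
Proof. exact: expi_mul_conj. Qed.

Lemma chi_neq0 a b : chi a b != 0.
Proof.
apply/eqP => chi_ab0; have /eqP := chi_mul_conj a b.
by rewrite chi_ab0 mul0r eq_sym oner_eq0.
Qed.

Lemma chi0 a : chi 0 a = 1.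
Proof. by rewrite chiE expr0. Qed.

Lemma chi_nontrivial a : a != 0 -> exists l, chi l a != 1.
Proof.
move=> a0; have a_gt0 : (0 < a)%N by rewrite lt0n.
have n_gt0 : (0 < n)%N by rewrite -ltnS; apply: leq_ltn_trans (ltn_ord a).
(* [inord 1] really is 1 because a nonzero [a] forces N > 1; the angle [2 pi a / N] then lies
   strictly between 0 and [2 pi]. *)
exists (inord 1); rewrite /chi inordK// mul1n; apply: expi_neq1.
  by rewrite !mulr_gt0 ?invr_gt0 ?ltr0n// pi_gt0.
by rewrite ltr_pdivrMr ?ltr0n// ltr_pM2l ?mulr_gt0 ?pi_gt0// ltr_nat ltn_ord.
Qed.

End Characters.

(** * Orthogonality of characters and Fourier inversion *)

Lemma sum_char_group (gT : finGroupType) (F : idomainType) (G : {group gT})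
    (f : gT -> F) (fM : forall x y, f (x * y)%g = f x * f y) g :
  g \in G -> f g != 1 -> \sum_(x in G) f x = 0.
Proof.
move=> gG fg1; apply/eqP.
have /eqP : \sum_(x in G) f x = f g * \sum_(x in G) f x.
  (* Translating the summation variable by [g] multiplies the sum by [f g], which differs from 1. *)
  rewrite mulr_sumr [LHS](reindex_inj (mulgI g)).
  by apply: eq_big => x; rewrite ?groupMl.
rewrite -subr_eq0 -[X in X - _]mul1r -mulrBl mulf_eq0 subr_eq0 eq_sym.
by rewrite (negPf fg1).
Qed.

Lemma sum_chi (R : realType) n (a : 'I_n.+1) :
  \sum_l chi R l a = n.+1%:R * (a == 0)%:R.
Proof.
case: (eqVneq a 0) => [->|/(@chi_nontrivial R)[l chi_l]].
  under eq_bigr do rewrite chiC chi0.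
  by rewrite sumr_const card_ord mulr1.
rewrite mulr0.
rewrite -(eq_bigl _ _ (in_setT (T := 'I_n.+1))).
exact: (sum_char_group (G := [set: 'I_n.+1]%G) (fun x y => chiDl _ x y a)
  (in_setT l) chi_l).
Qed.

(** Summing the coefficients against [chi R l j] and exchanging the sums leaves [N f(j)], by
    orthogonality. *)
Lemma fourier_inj (R : realType) n (f : 'I_n.+1 -> R[i]) :
  (forall l, \sum_k f k * (chi R l k)^* = 0) -> forall k, f k = 0.
Proof.
move=> f0 j.
have : \sum_l chi R l j * (\sum_k f k * (chi R l k)^*) = 0.
  by apply: big1 => l _; rewrite f0 mulr0.
under eq_bigr do rewrite mulr_sumr.
rewrite exchange_big /=.
under eq_bigr => k _.
  under eq_bigr => l _.
    have -> : chi R l j * (f k * (chi R l k)^*) = f k * chi R l (j - k).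
      apply: (mulIf (chi_neq0 R l k)); rewrite -[RHS]mulrA -chiDr subrK.
      by rewrite mulrCA -!mulrA (mulrC _ (chi _ _ _)) chi_mul_conj mulr1.
    over.
  rewrite -mulr_sumr sum_chi subr_eq0; over.
rewrite (bigD1 j)//= big1 => [|k /negPf kj]; last first.
  by rewrite eq_sym kj !mulr0.
by rewrite eqxx mulr1 addr0 => /eqP; rewrite mulf_eq0 pnatr_eq0 orbF => /eqP.
Qed.

(** * Sesquilinear forms, and tightness as a matrix identity *)

Definition herm_form (R : realType) n (B : 'M[R[i]]_n) (x y : 'cV_n) : R[i] :=
  (x^T *m B *m map_mx Num.conj y) 0 0.

Lemma herm_formE (R : realType) n (B : 'M[R[i]]_n) x y :
  herm_form B x y = \sum_i \sum_j x i 0 * B i j * (y j 0)^*.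
Proof.
rewrite /herm_form mxE exchange_big; apply: eq_bigr => j _.
by rewrite !mxE mulr_suml; apply: eq_bigr => i _; rewrite mxE.
Qed.

Lemma herm_form_delta (R : realType) n (B : 'M[R[i]]_n) a b :
  herm_form B (delta_mx a 0) (delta_mx b 0) = B a b.
Proof.
by rewrite /herm_form trmx_delta -rowE map_delta_mx -colE !mxE.
Qed.

(** Polarization: the form at [e_a + c e_b] leaves only the cross terms. Taking [c = 1] gives
    [B a b = - B b a], and [c = 'i] gives [B a b = B b a]. *)
Lemma herm_form_eq0 (R : realType) n (B : 'M[R[i]]_n) :
  (forall x, herm_form B x x = 0) -> B = 0.
Proof.
move=> B0; apply/matrixP => a b; rewrite mxE.
have addE (u v : 'M[R[i]]_1) : (u + v) 0 0 = u 0 0 + v 0 0 by rewrite mxE.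
have scaleE c (u : 'M[R[i]]_1) : (c *: u) 0 0 = c * u 0 0 by rewrite mxE.
have formD c : c^* * B a b + c * B b a = 0.
  have := B0 (delta_mx a 0 + c *: delta_mx b 0).
  rewrite /herm_form linearD map_mxD linearZ map_mxZ /= !mulmxDl !mulmxDr.
  rewrite -!scalemxAl -!scalemxAr !(addE, scaleE).
  rewrite -!/(herm_form _ _ _) !B0 !herm_form_delta.
  by rewrite !mulr0 addr0 add0r.
have := formD 1; have := formD 'i.
rewrite conjC1 conjCi !mul1r mulNr addrC -mulrBr => /eqP.
rewrite mulf_eq0 (negPf (neq0Ci _)) subr_eq0 => /eqP ->.
by rewrite -mulr2n => /eqP; rewrite mulrn_eq0 => /eqP.
Qed.
Lemma chiBl (R : realType) n (a b c : 'I_n.+1) :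
  chi R (a - b) c = chi R a c * (chi R b c)^*.
Proof.
by rewrite -[in RHS](subrK b a) [in RHS]chiDl -mulrA chi_mul_conj mulr1.
Qed.

Definition outer (R : realType) n (v : 'cV[R[i]]_n) : 'M_n :=
  \matrix_(i, j) (v i 0 * (v j 0)^*).

Lemma tight_frame_outer (R : realType) n (I : finType) (D : {set I})
    (v : I -> 'cV[R[i]]_n.+1) (A : R) :
  tight_frame_with_bound D v A <->
  0 < A /\ \sum_(p in D) outer (v p) = (A%:C%C)%:M.
Proof.
pose S := \sum_(p in D) outer (v p).
(* The transpose appears because [inner] conjugates its second argument: the coefficient of [x_i]
   times the conjugate of [x_j] is entry [(j, i)] of [S]. *)
have formE x : herm_form (S - (A%:C%C)%:M)^T x x =
    \sum_(p in D) `|inner x (v p)| ^+ 2 - A%:C%C * \sum_j `|x j 0| ^+ 2.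
  rewrite /herm_form linearB /= mulmxBr mulmxBl tr_scalar_mx mul_mx_scalar.
  rewrite -scalemxAl [LHS]mxE [X in _ + X]mxE [X in _ - X]mxE; congr (_ - _).
    rewrite -/(herm_form _ _ _) herm_formE.
    under [RHS]eq_bigr => p _.
      rewrite normCK /inner rmorph_sum mulr_suml.
      under eq_bigr do rewrite mulr_sumr.
      over.
    rewrite [RHS]exchange_big /=; apply: eq_bigr => i _.
    rewrite [RHS]exchange_big /=; apply: eq_bigr => j _.
    rewrite mxE summxE mulr_sumr mulr_suml; apply: eq_bigr => p _.
    rewrite mxE rmorphM /=. rewrite conjCK. ring.
  congr (_ * _); rewrite mxE; apply: eq_bigr => j _.
  by rewrite !mxE normCK.
split=> -[A0 SA]; split=> //.
  apply/eqP; rewrite -subr_eq0 -trmx_eq0; apply/eqP.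
  by apply: herm_form_eq0 => x; rewrite formE SA subrr.
move=> x; apply/eqP; rewrite -subr_eq0 -formE /S SA subrr.
by rewrite /herm_form trmx0 mulmx0 mul0mx mxE.
Qed.

(** * The ambiguity function extended linearly to matrices *)

Definition mx_ambiguity (R : realType) n (M : 'M[R[i]]_n.+1) (m l : 'I_n.+1)
    : R[i] :=
  n.+1%:R^-1 * \sum_k M (k + m) k * (chi R l k)^*.

Section Ambiguity.
Variables (R : realType) (n : nat).
Implicit Types (M : 'M[R[i]]_n.+1) (phi : 'cV[R[i]]_n.+1).
Implicit Types (p q : 'I_n.+1 * 'I_n.+1) (m l : 'I_n.+1).

Lemma mx_ambiguity_outer phi m l :
  mx_ambiguity (outer phi) m l = ambiguity phi m l.
Proof. by congr (_ * _); apply: eq_bigr => k _; rewrite mxE -expiN. Qed.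

Lemma mx_ambiguity_sum (I : finType) (P : pred I) (M : I -> 'M[R[i]]_n.+1) m l :
  mx_ambiguity (\sum_(p | P p) M p) m l = \sum_(p | P p) mx_ambiguity (M p) m l.
Proof.
rewrite /mx_ambiguity -mulr_sumr exchange_big; congr (_ * _).
by apply: eq_bigr => k _; rewrite summxE mulr_suml.
Qed.

Lemma mx_ambiguity_scalar (a : R[i]) m l :
  mx_ambiguity a%:M m l = a * ((m, l) == (0, 0))%:R.
Proof.
rewrite /mx_ambiguity; under eq_bigr do rewrite mxE -subr_eq0 addrAC subrr add0r.
rewrite -mulr_sumr -rmorph_sum; under eq_bigr do rewrite chiC.
rewrite sum_chi rmorphM /= !conjC_nat xpair_eqE -mulnb natrM -(mulr_natr a).
by rewrite mulrCA mulKf ?pnatr_eq0// -mulrA.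
Qed.

Lemma mx_ambiguity_inj M1 M2 :
  mx_ambiguity M1 =2 mx_ambiguity M2 -> M1 = M2.
Proof.
move=> eqM; apply/matrixP => i j; apply/eqP; rewrite -subr_eq0; apply/eqP.
(* Entry [(i, j)] sits at position [j] of the cyclic diagonal of offset [i - j]. *)
rewrite -(subrK j i) (addrC _ j).
apply: (fourier_inj (f := fun k => M1 (k + (i - j)) k - M2 (k + (i - j)) k)).
move=> l; under eq_bigr do rewrite mulrBl.
rewrite sumrB; apply/eqP; rewrite subr_eq0; apply/eqP.
by apply: (mulfI (_ : n.+1%:R^-1 != 0)); [rewrite invr_eq0 pnatr_eq0 | apply: eqM].
Qed.

(* The scalar [c] such that
   [e_l tau_k o e_l' tau_k' = c e_l' tau_k' o e_l tau_k],
   for [q = (k', l')] and [p = (k, l)]. *)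
Definition comm_char q p : R[i] := chi R q.1 p.2 * (chi R q.2 p.1)^*.

Lemma comm_charM q p1 p2 :
  comm_char q (p1 * p2)%g = comm_char q p1 * comm_char q p2.
Proof. by rewrite /comm_char /= !chiDr rmorphM mulrACA. Qed.

Lemma in_adjointP (Lambda : {set 'I_n.+1 * 'I_n.+1}) q :
  in_adjoint R Lambda q <-> forall p, p \in Lambda -> comm_char q p = 1.
Proof.
(* Translations fix the constant vector, so its entry 0 retains only the conjugates of
   [chi R q.1 p.2] and [chi R p.1 q.2]. *)
split=> [adj p /adj /(_ (const_mx 1)) /matrixP /(_ 0 0)|comm1 p /comm1 comm psi].
  rewrite !mxE !mulr1 -!/(chi _ _ _) !chi0 !mul1r !sub0r -[- q.1]sub0r.
  rewrite -[- p.1]sub0r !chiBl !chi0 !mul1r /comm_char (chiC _ q.2) => <-.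
  exact: chi_mul_conj.
apply/matrixP => j i; rewrite !mxE -!/(chi _ _ _) !chiBl.
have -> : chi R p.1 q.2 = chi R q.1 p.2.
  rewrite chiC -[LHS]mul1r -comm -mulrA [_^* * _]mulrC chi_mul_conj.
  exact: mulr1.
by rewrite addrAC !mulrA; congr (_ * _ * _); rewrite mulrC.
Qed.

Lemma mx_ambiguity_gabor phi q p :
  mx_ambiguity (outer (gabor phi p)) q.1 q.2 =
  comm_char q p * ambiguity phi q.1 q.2.
Proof.
rewrite -mx_ambiguity_outer /mx_ambiguity mulrCA; congr (_ * _).
(* Shifting the index by [p.1] undoes the translation of [phi]. *)
rewrite mulr_sumr (reindex_inj (addIr p.1)) /=; apply: eq_bigr => k _.
rewrite !mxE -!/(chi _ _ _) addrK addrAC addrK !rmorphM /= /comm_char.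
rewrite (addrAC k) (chiDl _ _ q.1) chiDr rmorphM /=.
(* The inserted 1 is the modulation phase at [k + p.1] times its conjugate, the pair present on the
   left. *)
rewrite -[RHS]mul1r -(chi_mul_conj R (k + p.1) p.2); ring.
Qed.

Lemma ambiguity00 phi :
  ambiguity phi 0 0 = n.+1%:R^-1 * \sum_k `|phi k 0| ^+ 2.
Proof.
rewrite -mx_ambiguity_outer; congr (_ * _); apply: eq_bigr => k _.
by rewrite mxE addr0 chi0 conjC1 mulr1 normCK.
Qed.

Lemma ambiguity00_gt0 phi : phi != 0 -> 0 < ambiguity phi 0 0.
Proof.
move=> phi0; rewrite ambiguity00 mulr_gt0 ?invr_gt0 ?ltr0n//.
have sq_ge0 (k : 'I_n.+1) : true -> 0 <= `|phi k 0| ^+ 2 by rewrite exprn_ge0.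
rewrite lt_def sumr_ge0// andbT; apply: contra phi0.
rewrite psumr_eq0// => /allP phi0; apply/eqP/colP => k; rewrite mxE.
by have := phi0 k (mem_index_enum k); rewrite expf_eq0 normr_eq0 => /eqP.
Qed.

Lemma sum_comm_char (Lambda : {group 'I_n.+1 * 'I_n.+1}) q :
  \sum_(p in Lambda) comm_char q p =
    #|Lambda|%:R * [forall p in Lambda, comm_char q p == 1]%:R.
Proof.
have [/forall_inP adj|] := boolP [forall p in Lambda, comm_char q p == 1].
  rewrite (eq_bigr (fun=> 1)) ?sumr_const ?mulr1// => p pL.
  exact/eqP/adj.
rewrite negb_forall_in mulr0 => /exists_inP[p pL p1].
by rewrite (sum_char_group (comm_charM q) pL p1).
Qed.

Lemma mx_ambiguity_frame (Lambda : {group 'I_n.+1 * 'I_n.+1}) phi q :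
  mx_ambiguity (\sum_(p in Lambda) outer (gabor phi p)) q.1 q.2 =
  #|Lambda|%:R * [forall p in Lambda, comm_char q p == 1]%:R *
    ambiguity phi q.1 q.2.
Proof.
rewrite mx_ambiguity_sum -sum_comm_char mulr_suml.
by apply: eq_bigr => p _; rewrite mx_ambiguity_gabor.
Qed.

(** * The two implications and the frame bound *)

Lemma gabor_tight_bound (Lambda : {group 'I_n.+1 * 'I_n.+1}) phi (A : R) :
  tight_frame_with_bound Lambda (gabor phi) A ->
  adjoint_sparse Lambda phi /\ A%:C%C = #|Lambda|%:R * ambiguity phi 0 0.
Proof.
move=> /tight_frame_outer[_ SA].
have amb q : in_adjoint R Lambda q ->
    #|Lambda|%:R * ambiguity phi q.1 q.2 = A%:C%C * (q == (0, 0))%:R.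
  move=> /in_adjointP adj; have := mx_ambiguity_frame Lambda phi q.
  rewrite SA mx_ambiguity_scalar -surjective_pairing => ->.
  have -> : [forall p in Lambda, comm_char q p == 1]; last by rewrite mulr1.
  by apply/forall_inP => p /adj ->.
split=> [m l /amb /= + /eqP/negPf ml0|].
  rewrite ml0 mulr0 => /eqP; rewrite mulf_eq0 pnatr_eq0 eqn0Ngt cardG_gt0.
  by move/eqP.
(* The origin always lies in the adjoint, and the coefficient there determines the bound. *)
have /amb /= -> : in_adjoint R Lambda (0, 0).
  by apply/in_adjointP => p _; rewrite /comm_char !chi0 conjC1 mulr1.
by rewrite mulr1.
Qed.

End Ambiguity.

Theorem theorem2p8 (R : realType) (n : nat) (phi : 'cV[R[i]]_n.+1)
    (Lambda : {group 'I_n.+1 * 'I_n.+1}) (phi_neq0 : phi != 0) :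
  (tight_frame Lambda (gabor phi) <-> adjoint_sparse Lambda phi) /\
  (forall A : R, tight_frame_with_bound Lambda (gabor phi) A ->
     A%:C%C = #|Lambda|%:R * ambiguity phi 0 0).
Proof.
split; last by move=> A /gabor_tight_bound[].
split=> [[A /gabor_tight_bound[]]//|sparse].
have : 0 < #|Lambda|%:R * ambiguity phi 0 0.
  by rewrite mulr_gt0 ?ambiguity00_gt0// ltr0n cardG_gt0.
(* A positive element of [R[i]] has zero imaginary part; its real part [A] is the bound. *)
case E : (_ * _) => [A b]; rewrite ltcE /= => /andP[/eqP b0 A0].
move: E; rewrite b0 => E; exists A; apply/tight_frame_outer; split=> //.
apply: mx_ambiguity_inj => m l.
rewrite (mx_ambiguity_frame Lambda phi (m, l)) mx_ambiguity_scalar /=.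
case: (eqVneq (m, l) (0, 0)) => [[-> ->]|/eqP ml0].
  rewrite mulr1 -[RHS]E; congr (_ * _).
  have -> : [forall p in Lambda, comm_char R (0, 0) p == 1]; last exact: mulr1.
  by apply/forall_inP => p _; rewrite /comm_char !chi0 conjC1 mulr1.
(* Off the origin, sparsity kills the coefficients inside the adjoint and orthogonality those
   outside. *)
rewrite mulr0; case: forall_inP => [adj|_].
  rewrite sparse ?mulr0//; apply/in_adjointP => p pL; exact/eqP/adj.
by rewrite mulr0 mul0r.
Qed.
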